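(* Let $k \subseteq l \subseteq \overline{\mathbb{Q}}$ be algebraic number fields with $e = [l:k]$, and let $\omega_1, \dots, \omega_e \in l$ be a basis of $l$ as a $k$-vector space such that the full $O_k$-module $$\mathfrak M = \{\omega_1\nu_1 + \cdots + \omega_e\nu_e : \nu_i \in O_k\}$$ is contained in $O_l$. Assume that the rank $r(l/k)$ of the group $\mathcal E_{l/k}(\mathfrak M)$ of relative units (defined below) is zero. Assume further that $\beta \neq 0$ is a point in $O_k$ and $\mu \neq 0$ is a point in $\mathfrak M$ with $\mathrm{Norm}_{l/k}(\mu) = \zeta\beta$ for some $\zeta \in \mathrm{Tor}(O_k^\times)$. Then $$h(\mu) = [l:k]^{-1} h(\beta).$$
   Context: Notation and conventions. - For a number field $F$, $O_F$ is its ring of integers, $O_F^\times$ its unit group, and $\mathrm{Tor}(O_F^\times)$ the group of roots of unity in $F$. We write $\mathrm{Norm}_{l/k}: l^\times \to k^\times$ for the norm. - The coefficient ring of $\mathfrak M$ is $O_{\mathfrak M} = \{\alpha \in l : \alpha\mathfrak M \subseteq \mathfrak M\}$, and $O_{\mathfrak M}^\times = O_{\mathfrak M} \cap O_l^\times$. - The group of relative units is $$\mathcal E_{l/k}(\mathfrak M) = \{\alpha \in O_{\mathfrak M}^\times : \mathrm{Norm}_{l/k}(\alpha) \in \mathrm{Tor}(O_k^\times)\}.$$ Its rank is $r(l/k) = r(l) - r(k)$, where $r(\cdot)$ is the rank of the unit group. - Absolute values: for each place $w$ of $l$, $|\cdot|_w = \|\cdot\|_w^{d_w/d}$, where $\|\cdot\|_w$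 extends the usual absolute value on $\mathbb{Q}$, $d_w = [l_w:\mathbb{Q}_w]$ and $d = [l:\mathbb{Q}]$. - Weil height: $h(\alpha) = \sum_w \log^+|\alpha|_w$, summed over all places $w$ of $l$. It is independent of the choice of number field containing $\alpha$. *)

(* Defs.v *)
From HB Require Import structures.
From mathcomp Require Import all_boot all_order all_algebra all_field.
From mathcomp Require Import all_classical all_reals all_analysis.

Set Implicit Arguments.
Unset Strict Implicit.
Unset Printing Implicit Defensive.

Import Order.TTheory GRing.Theory Num.Theory.
Local Open Scope classical_set_scope.
Local Open Scope ring_scope.

(* A number field l is an L : fieldExtType rat; a subfield k of l is a
   K : {subfield L}, whose elements are elements of L. *)

Section RelativeUnits.
Variables (L : fieldExtType rat) (K : {subfield L}).

Definition integers (F : {subfield L}) : set L :=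
  [set x | x \in F /\ integralOver (intr : int -> L) x].

Definition int_units (F : {subfield L}) : set L :=
  [set x | [/\ x != 0, integers F x & integers F x^-1]].

Definition tor_units (F : {subfield L}) : set L :=
  [set x | int_units F x /\ exists2 n : nat, (0 < n)%N & x ^+ n = 1].

(* The norm is the determinant of the K-linear map y |-> x * y; fieldOver K is
   L viewed as an extension of the field subvs_of K. The basis vbasis of the
   full space is an arbitrary one. *)
Definition rel_norm (x : L) : L :=
  let b := vbasis (fullv : {vspace fieldOver K}) in
  vsval (\det (passmx.mxof b b (amull (x : fieldOver K)))).

Definition full_module (e : nat) (omega : e.-tuple (fieldOver K)) : set L :=
  [set x | exists2 nu : 'I_e -> L,
     forall i, integers K (nu i) & x = \sum_(i < e) (tnth omega i : L) * nu i].

Definition coef_ring (M : set L) : set L :=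
  [set a | forall x, M x -> M (a * x)].

Definition coef_units (M : set L) : set L :=
  coef_ring M `&` int_units {:L}%AS.

Definition relative_units (M : set L) : set L :=
  [set a | coef_units M a /\ tor_units K (rel_norm a)].

End RelativeUnits.

Definition mult_independent (F : fieldType) (n : nat) (u : 'I_n -> F) : Prop :=
  forall m : 'I_n -> int, \prod_(i < n) u i ^ m i = 1 -> forall i, m i = 0.

(* Torsion-free rank of a subgroup G of the multiplicative group of F. *)
Definition has_rank (F : fieldType) (G : set F) (r : nat) : Prop :=
  (exists u : 'I_r -> F, (forall i, G (u i)) /\ mult_independent u) /\
  (forall (n : nat) (u : 'I_n -> F),
     (forall i, G (u i)) -> mult_independent u -> (n <= r)%N).

Section AbsoluteValues.
Variables (R : realType) (F : fieldType).

Definition absolute_value (w : F -> R) : Prop :=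
  [/\ forall x, 0 <= w x,
      forall x, w x = 0 <-> x = 0,
      forall x y, w (x * y) = w x * w y &
      forall x y, w (x + y) <= w x + w y].

Definition abs_cauchy (w : F -> R) (u : nat -> F) : Prop :=
  forall eps : R, 0 < eps ->
    exists N : nat, forall m n, (N <= m)%N -> (N <= n)%N -> w (u m - u n) < eps.

Definition abs_cvg (w : F -> R) (u : nat -> F) (x : F) : Prop :=
  forall eps : R, 0 < eps ->
    exists N : nat, forall n, (N <= n)%N -> w (u n - x) < eps.

Definition abs_complete (w : F -> R) : Prop :=
  forall u, abs_cauchy w u -> exists x, abs_cvg w u x.

Definition abs_closure (w : F -> R) (A : set F) : set F :=
  [set x | forall eps : R, 0 < eps -> exists2 a, A a & w (x - a) < eps].

End AbsoluteValues.

(* A completion of (F, w): a complete valued field in which F embeds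
   isometrically with dense image (unique up to unique isomorphism). *)
Record completion (R : realType) (F : fieldType) (w : F -> R) := Completion {
  compl_field : fieldType;
  compl_abs : compl_field -> R;
  compl_emb : {rmorphism F -> compl_field};
  compl_absP : absolute_value compl_abs;
  compl_embP : forall x, compl_abs (compl_emb x) = w x;
  compl_dense : abs_closure compl_abs (range compl_emb) = setT;
  compl_complete : abs_complete compl_abs
}.

(* The subset k of F is meant to be a subfield. *)
Definition has_degree_over (F : fieldType) (k : set F) (n : nat) : Prop :=
  exists b : 'I_n -> F, forall x : F,
    exists! c : 'I_n -> F, (forall i, k (c i)) /\ x = \sum_(i < n) c i * b i.

Definition padic_abs (R : realType) (p : nat) (q : rat) : R :=
  if q == 0 then 0
  else p%:R ^ ((logn p `|denq q|%N)%:Z - (logn p `|numq q|%N)%:Z).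

Section WeilHeight.
Variables (R : realType) (L : fieldExtType rat).

(* Each place of L is represented by its unique absolute value extending the
   usual archimedean or a usual p-adic absolute value of the rationals. *)
Definition places : set (L -> R) :=
  [set w | absolute_value w /\
    ((forall q : rat, w q%:A = `|ratr q|) \/
     (exists2 p : nat, prime p & forall q : rat, w q%:A = padic_abs R p q))].

(* n = [L_w : Q_w]; the completion Q_w of the rationals is realized as the
   closure of the rationals in L_w. *)
Definition is_local_degree (w : L -> R) (n : nat) : Prop :=
  exists C : completion w,
    has_degree_over
      (abs_closure (@compl_abs _ _ _ C)
         (range (fun q : rat => compl_emb C q%:A))) n.

Definition local_degree (w : L -> R) : nat :=
  xget 0%N [set n | is_local_degree w n].

Definition normalized_abs (w : L -> R) (x : L) : R :=
  w x `^ ((local_degree w)%:R / (\dim {:L})%:R).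

Definition ln_plus (t : R) : R := Num.max 0 (ln t).

(* The finitely supported sum over all places; for t = 0 the library's ln t is
   0, so ln_plus 0 = 0 as it should be. *)
Definition weil_height (x : L) : R :=
  \sum_(w \in places) ln_plus (normalized_abs w x).

End WeilHeight.

(* Main.v *)
Require Import Defs.
From HB Require Import structures.
From mathcomp Require Import all_boot all_order all_algebra all_field.
From mathcomp Require Import all_classical all_reals all_analysis.

(** For an archimedean place [w] it suffices that [w (N mu) = w mu ^+ e]; at the
    other places both heights vanish, [mu] and [beta] being integral. Put
    [theta = mu ^+ e / N mu], so [N theta = 1]. Inside the coefficient ring of
    the module take a full lattice; multiplied by [phi ^+ t], where [phi] is
    whichever of [theta], [theta^-1] has absolute norm at most 1 in size, it
    contains by the pigeonhole principle a nonzero [x t = phi ^+ t * alpha t]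
    with bounded coordinates. The relative norms [N (alpha t) = N (x t)] are
    bounded and lie in a discrete ring, so for infinitely many [t] they
    coincide, and so do the classes of [alpha t] modulo a suitable
    integer. Quotients of such [alpha t] are relative units, hence roots of
    unity as the rank is 0, so that [w (x t)] is [w phi ^+ t] up to a constant.
    Since [x t] and its cofactor [N (x t) / x t] are both bounded, [w phi = 1].
    Only the coordinates over the rationals are used: neither complex embeddings
    nor local degrees occur. *)

Set Implicit Arguments.
Unset Strict Implicit.
Unset Printing Implicit Defensive.

Import Order.TTheory GRing.Theory Num.Theory.
Local Open Scope classical_set_scope.
Local Open Scope ring_scope.

(** * Short vectors in integral and rational lattices *)

Lemma clear_denominators (I : finType) (q : I -> rat) :
  exists2 N : nat, (0 < N)%N & forall i, N%:R * q i \is a Num.int.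
Proof.
exists (\prod_i `|denq (q i)|)%N.
  by apply: prodn_gt0 => i; rewrite absz_gt0 denq_neq0.
move=> i; rewrite (bigD1 i) //= natrM mulrAC rpredM ?rpred_nat //.
have -> : `|denq (q i)|%:R = (denq (q i))%:~R :> rat.
  by rewrite -[in RHS]absz_denq.
by rewrite mulrC -{1}[q i]divq_num_den mulfVK ?intr_eq0 ?denq_neq0 // intr_int.
Qed.

(* There are [`|\det H|] classes modulo the row lattice of [H], fewer than the
   [(N + 1) ^ n] points of the box. *)
Lemma int_lattice_pigeonhole n (H : 'M[int]_n) (N : nat) :
    \det H != 0 -> (`|\det H| <= N ^ n)%N -> (0 < n)%N ->
  exists2 z : 'rV[int]_n, z != 0 & forall j, `|(z *m H) 0 j| <= N%:Z.
Proof.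
(* [H] is [P *m D *m Q] with [P], [Q] unimodular and [D] diagonal: after multiplication by
   [invmx Q], membership in the row lattice becomes divisibility of the coordinates by the [s_i]. *)
move=> H0 Hle n0; have [P uP [Q uQ [s _ EH]]] := int_Smith_normal_form H.
pose D : 'M[int]_n := diag_mx (\row_i s`_i).
have ED : (\matrix_(i, j) (s`_i *+ (i == j :> nat))) = D.
  by apply/matrixP => i j; rewrite !mxE.
rewrite {}ED in EH.
have detU (U : 'M[int]_n) : U \in unitmx -> `|\det U|%N = 1%N.
  move=> uU; apply/eqP; have := congr1 absz (congr1 determinant (mulmxV uU)).
  by rewrite det_mulmx det1 abszM => /eqP; rewrite muln_eq1 => /andP[].
have EdH : `|\det H|%N = (\prod_(i < n) `|(s`_i)%R|)%N.
  rewrite EH !det_mulmx !abszM (detU P) // (detU Q) // mul1n muln1 det_diag.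
  rewrite (big_morph absz abszM (erefl : absz 1 = 1%N)).
  by apply: eq_bigr => i _; rewrite mxE.
have s0 (i : 'I_n) : s`_i != 0.
  have := H0; rewrite -absz_eq0 EdH -lt0n => h.
  apply/eqP => si0; move: h.
  by rewrite (bigD1 (i : 'I_n)) //= si0 mul0n.
pose vec (y : {ffun 'I_n -> 'I_N.+1}) : 'rV[int]_n := \row_i (y i : nat)%:Z.
have ltS y (i : 'I_n) :
    (`|modz ((vec y *m invmx Q) 0 i)%R (s`_i)%R| < `|(s`_i)%R|)%N.
  by rewrite -ltz_nat gez0_abs ?modz_ge0 // abszE ltz_mod.
(* The residues modulo the [s_i] label the class of [vec y] modulo the row lattice. *)
pose code y : {dffun forall i : 'I_n, 'I_(`|(s`_i)%R|)} :=
  [ffun i => Ordinal (ltS y i)].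
have /injectivePn[y [y' yy' Ecode]] : ~~ injectiveb code.
  apply/negP => /injectiveP /leq_card.
  rewrite card_ffun card_dep_ffun foldrE big_map big_enum /= !card_ord.
  under eq_bigr do rewrite card_ord.
  rewrite -EdH => /leq_trans/(_ Hle); rewrite leq_exp2r //.
  by rewrite ltnn.
pose z := \row_i divz (((vec y - vec y') *m invmx Q) 0 i) (s`_i).
have zD : z *m D = (vec y - vec y') *m invmx Q.
  apply/rowP => i; rewrite mul_mx_diag mxE [z 0 i]mxE.
  rewrite [(\row_i _) 0 i]mxE divzK //.
  move/ffunP/(_ i): Ecode; rewrite !ffunE => /(congr1 val) /= /(congr1 Posz).
  rewrite !gez0_abs ?modz_ge0 // => /eqP; rewrite eqz_mod_dvd.
  by rewrite mulmxBl [X in _ -> (_ %| X)%Z]mxE [X in _ -> (_ %| _ + X)%Z]mxE.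
have zH : z *m invmx P *m H = vec y - vec y'.
  by rewrite EH !mulmxA mulmxKV // zD mulmxKV.
exists (z *m invmx P).
  apply: contra_neq yy' => z0; move: zH; rewrite z0 mul0mx => /esym/eqP.
  rewrite subr_eq0 => /eqP/rowP e; apply/ffunP => i; apply: val_inj.
  by have := e i; rewrite !mxE => -[].
move=> j; rewrite zH !mxE.
have [l1 l2] := (ltn_ord (y j), ltn_ord (y' j)).
move: (val (y j)) (val (y' j)) l1 l2 => a b; rewrite !ltnS -!lez_nat => l1 l2.
have [a0 b0] : (0 <= a%:Z) /\ (0 <= b%:Z) by [].
rewrite ler_norml lerBrDr lerBlDr [X in _ && X](le_trans l1) ?lerDl // andbT.
by rewrite (le_trans _ a0) // addrC subr_le0.
Qed.

(** A form of Minkowski's theorem for the unit cube. With [N] a common denominator, [H = N G] is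
    integral and [|\det H| = N ^ n |\det G| <= N ^ n], so the integral pigeonhole applies to the box
    of side [N]. *)
Lemma rat_lattice_box n (G : 'M[rat]_n) :
    (0 < n)%N -> \det G != 0 -> `|\det G| <= 1 ->
  exists2 z : 'rV[int]_n, z != 0 &
    forall j, `|(map_mx intr z *m G) 0 j| <= 1.
Proof.
move=> n0 G0 G1; have [N N0 hN] :=
  clear_denominators (fun ij : 'I_n * 'I_n => G ij.1 ij.2).
pose H : 'M[int]_n := \matrix_(i, j) Num.floor (N%:R * G i j).
have EH : map_mx intr H = N%:R *: G.
  apply/matrixP => i j; rewrite !mxE.
  by apply/eqP; rewrite -intrEfloor; have := hN (i, j).
have EdH : (\det H)%:~R = N%:R ^+ n * \det G by rewrite -det_map_mx EH detZ.
have Nn0 : (N%:R : rat) != 0 by rewrite pnatr_eq0 -lt0n.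
have [] := @int_lattice_pigeonhole n H N _ _ n0.
- by rewrite -(intr_eq0 rat) EdH mulf_neq0 ?expf_neq0.
- rewrite -lez_nat abszE -(ler_int rat) intr_norm EdH normrM.
  rewrite ger0_norm ?exprn_ge0 ?ler0n //.
  by rewrite -[X in _ <= X]/((N ^ n)%:R) natrX ler_piMr // exprn_ge0 ?ler0n.
move=> z z0 zH; exists z => // j.
have := zH j; rewrite -(ler_int rat) intr_norm.
have -> : ((z *m H) 0 j)%:~R = N%:R * (map_mx intr z *m G) 0 j.
  have : map_mx (intr : int -> rat) (z *m H) 0 j =
      (N%:R *: (map_mx intr z *m G)) 0 j.
    by rewrite map_mxM EH scalemxAr.
  by rewrite !mxE.
by rewrite normrM normr_nat -[X in _ <= X]/(N%:R) ger_pMr ?ltr0n.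
Qed.

(** Infinitely many [t], in a form that passes to one class of a finite partition without extracting
    a subsequence. *)
Definition unbounded (P : nat -> Prop) := forall N, exists2 t, (N <= t)%N & P t.

Lemma unbounded_pigeonhole (P : nat -> Prop) (T : finType) (f : nat -> T) :
  unbounded P -> exists c, unbounded (fun t => P t /\ f t = c).
Proof.
move=> unbP; apply: contrapT => /forallNP nunb.
have /choice[b hb] c : exists N, forall t, (N <= t)%N -> P t -> f t <> c.
  apply: contrapT => /forallNP nb; apply: (nunb c) => N.
  move: (nb N) => /existsNP[t /not_implyP[Nt /not_implyP[Pt /contrapT ft]]].
  by exists t.
have [t bt Pt] := unbP (\max_c b c)%N.
by apply: (hb (f t) t) => //; apply: leq_trans bt; apply: leq_bigmax.
Qed.

(** * The regular representation of a field extension *)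

Section RegularRepresentation.
Variables (F : fieldType) (L : fieldExtType F).

(** Row [i] holds the coordinates of [x * b_i], the convention of [passmx.mxof]. *)
Definition regmx n (b : n.-tuple L) (x : L) : 'M[F]_n :=
  \matrix_(i, j) coord b j (x * b`_i).

Section OneBasis.
Variables (n : nat) (b : n.-tuple L) (hb : basis_of {:L} b).

Lemma basis_expand (x : L) : x = \sum_i coord b i x *: b`_i.
Proof. exact: coord_basis hb (memvf x). Qed.

Lemma regmxE x (i : 'I_n) : x * b`_i = \sum_j regmx b x i j *: b`_j.
Proof. by rewrite [LHS]basis_expand; apply: eq_bigr => j _; rewrite mxE. Qed.

Lemma regmx_unique x (M : 'M[F]_n) :
  (forall i : 'I_n, x * b`_i = \sum_j M i j *: b`_j) -> regmx b x = M.
Proof.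
move=> hM; apply/matrixP => i j.
by rewrite mxE hM coord_sum_free ?(basis_free hb).
Qed.

Lemma regmxD x y : regmx b (x + y) = regmx b x + regmx b y.
Proof. by apply/matrixP => i j; rewrite !mxE mulrDl linearD. Qed.

Lemma regmxZ c x : regmx b (c *: x) = c *: regmx b x.
Proof. by apply/matrixP => i j; rewrite !mxE -scalerAl linearZ. Qed.

Lemma regmxN x : regmx b (- x) = - regmx b x.
Proof. by rewrite -scaleN1r regmxZ scaleN1r. Qed.

Lemma regmx1 : regmx b 1 = 1%:M.
Proof.
apply: regmx_unique => i; rewrite mul1r (bigD1 i) //= mxE eqxx scale1r.
by rewrite big1 ?addr0 // => j ji; rewrite mxE eq_sym (negPf ji) scale0r.
Qed.

Lemma regmxM x y : regmx b (x * y) = regmx b x *m regmx b y.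
Proof.
apply: regmx_unique => i; rewrite [x * y]mulrC -mulrA regmxE mulr_sumr.
under eq_bigr => k _ do rewrite -scalerAr regmxE scaler_sumr.
rewrite exchange_big /=; apply: eq_bigr => j _.
by rewrite mxE scaler_suml; apply: eq_bigr => k _; rewrite scalerA.
Qed.

Lemma regmx_inj : injective (regmx b).
Proof.
move=> x y exy.
(* Expanding 1 in the basis recovers [z = z * 1] from the matrix of [z]. *)
have e1 z : z = \sum_i coord b i 1 *: (\sum_j regmx b z i j *: b`_j).
  rewrite -[z in LHS]mulr1 [1 in LHS]basis_expand mulr_sumr.
  by apply: eq_bigr => i _; rewrite -regmxE scalerAr.
by rewrite (e1 x) (e1 y) exy.
Qed.

End OneBasis.

(** The change-of-basis matrices are inverse to each other, so the two matrices of [x] are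
    conjugate. This allows [rel_norm], defined with an arbitrary basis, to be computed in
    [omega]. *)
Lemma det_regmx n n' (b : n.-tuple L) (b' : n'.-tuple L) x :
  basis_of {:L} b -> basis_of {:L} b' -> \det (regmx b x) = \det (regmx b' x).
Proof.
move=> hb hb'; have en : n = n'.
  by rewrite -(size_basis hb) (size_basis hb').
case: n' / en b' hb' => b' hb'.
pose P (c c' : n.-tuple L) : 'M[F]_n := \matrix_(i, j) coord c' j c`_i.
have EP (c c' : n.-tuple L) : basis_of {:L} c' ->
    forall i : 'I_n, c`_i = \sum_j P c c' i j *: c'`_j.
  move=> hc i; rewrite [LHS](basis_expand hc).
  by apply: eq_bigr => j _; rewrite mxE.
have PP : P b b' *m P b' b = 1%:M.
  rewrite -(regmx1 hb); apply/esym/(regmx_unique hb) => i.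
  rewrite mul1r [LHS](EP b b' hb').
  under eq_bigr => k _ do rewrite [b'`_k](EP b' b hb) scaler_sumr.
  rewrite exchange_big /=; apply: eq_bigr => j _.
  by rewrite [in RHS]mxE scaler_suml; apply: eq_bigr => k _; rewrite scalerA.
have -> : regmx b x = P b b' *m regmx b' x *m P b' b.
  apply: (regmx_unique hb) => i; rewrite [b`_i in LHS](EP b b' hb') mulr_sumr.
  under eq_bigr => k _ do rewrite -scalerAr (regmxE hb') scaler_sumr.
  rewrite exchange_big /=.
  under eq_bigr => j _.
    rewrite [b'`_j](EP b' b hb).
    under eq_bigr => k _ do rewrite scalerA.
    rewrite -scaler_suml scaler_sumr.
    over.
  rewrite exchange_big /=; apply: eq_bigr => j _.
  rewrite [in RHS]mxE scaler_suml; apply: eq_bigr => k _.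
  by rewrite scalerA [(P b b' *m _) i k]mxE.
by rewrite !det_mulmx mulrAC -det_mulmx PP det1 mul1r.
Qed.

Lemma mxof_amull (b : (\dim {:L}).-tuple L) x :
  passmx.mxof b b (amull x) = regmx b x.
Proof.
by apply/matrixP => i j; rewrite !mxE /= passmx.vecof_delta lfunE /=.
Qed.

End RegularRepresentation.

(** * Matrices of multiplication over the subfield *)

Section RelativeMatrix.
Variables (L : fieldExtType rat) (K : {subfield L}) (e : nat).
Variables (omega : e.-tuple (fieldOver K)).
Hypothesis homega : basis_of (fullv : {vspace fieldOver K}) omega.

(** The entries are moved from the subfield type into [L], where integrality and boundedness are
    expressed. *)
Definition relmx (x : L) : 'M[L]_e :=
  map_mx vsval (regmx omega (x : fieldOver K)).

Lemma relmx_in x i j : relmx x i j \in K.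
Proof. by rewrite mxE subvsP. Qed.

Lemma relmxE x (i : 'I_e) :
  x * (tnth omega i : L) = \sum_j relmx x i j * (tnth omega j : L).
Proof.
rewrite !(tnth_nth 0).
apply: etrans (regmxE homega (x : fieldOver K) i) _.
by apply: eq_bigr => j _; rewrite fieldOver_scaleE !mxE (tnth_nth 0).
Qed.

Lemma relmxD x y : relmx (x + y) = relmx x + relmx y.
Proof. by rewrite /relmx (regmxD omega) map_mxD. Qed.

Lemma relmx1 : relmx 1 = 1%:M.
Proof. by rewrite /relmx (regmx1 homega) map_mx1. Qed.

Lemma relmxM x y : relmx (x * y) = relmx x *m relmx y.
Proof. by rewrite /relmx (regmxM homega) map_mxM. Qed.

Lemma relmxZ c x : c \in K -> relmx (c * x) = c *: relmx x.
Proof.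
move=> cK; have -> : c * x = (vsproj K c *: (x : fieldOver K)).
  by rewrite fieldOver_scaleE vsprojK.
by rewrite /relmx regmxZ map_mxZ /= vsprojK.
Qed.

Lemma relmx_scalar c : c \in K -> relmx c = c%:M.
Proof. by move=> cK; rewrite -[c in LHS]mulr1 relmxZ // relmx1 scalemx1. Qed.

Lemma rel_normE x : rel_norm K x = \det (relmx x).
Proof.
rewrite /rel_norm mxof_amull /relmx det_map_mx; congr vsval.
exact: (det_regmx _ (vbasisP _) homega).
Qed.

End RelativeMatrix.

(** * Determinants, adjugates and characteristic polynomials over a subring *)

Section MatrixOverSubring.
Variables (S : comNzRingType) (P : subringClosed S).

Lemma det_mxOver n (M : 'M[S]_n) : M \is a mxOver P -> \det M \in P.
Proof.
move=> /mxOverP MP; rewrite rpred_sum // => s _.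
by rewrite rpredMsign rpred_prod // => i _; apply: MP.
Qed.

Lemma adj_mxOver n (M : 'M[S]_n) : M \is a mxOver P -> \adj M \is a mxOver P.
Proof.
move=> /mxOverP MP; apply/mxOverP => i j; rewrite mxE rpredMsign.
by apply: det_mxOver; apply/mxOverP => k l; rewrite !mxE.
Qed.

Lemma char_poly_polyOver n (M : 'M[S]_n) :
  M \is a mxOver P -> char_poly M \is a polyOver P.
Proof.
move=> /mxOverP MP; rewrite rpred_sum // => s _.
rewrite rpredMsign rpred_prod // => i _.
by rewrite !mxE rpredB ?polyOverC ?MP // rpredMn // polyOverX.
Qed.

End MatrixOverSubring.

(** * Bounded sequences and a discrete order of [L] *)

Section Bounded.
Variable L : fieldExtType rat.
Local Notation lam := (vbasis {:L}).
Local Notation d := (\dim {:L}).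

Lemma vbasis_fullP : basis_of {:L} lam. Proof. exact: vbasisP. Qed.

(** Rational coordinates stand in for the archimedean embeddings: a bound on them gives a bound at
    every archimedean place. *)
Definition bounded_seq (f : nat -> L) :=
  exists C : rat, forall t i, `|coord lam i (f t)| <= C.

Lemma eq_bounded_seq f g :
  (forall t, f t = g t) -> bounded_seq f -> bounded_seq g.
Proof. by move=> fg [C hC]; exists C => t i; rewrite -fg. Qed.

Lemma bounded_seq_cst c : bounded_seq (fun=> c).
Proof.
exists (\sum_i `|coord lam i c|) => t i; rewrite (bigD1 i) //= lerDl.
by rewrite sumr_ge0.
Qed.

Lemma bounded_seqD f g :
  bounded_seq f -> bounded_seq g -> bounded_seq (fun t => f t + g t).
Proof.
move=> [C hC] [D hD]; exists (C + D) => t i; rewrite linearD /=.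
by rewrite (le_trans (ler_normD _ _)) // lerD.
Qed.

Lemma bounded_seqZ (q : nat -> rat) C g : (forall t, `|q t| <= C) ->
  bounded_seq g -> bounded_seq (fun t => q t *: g t).
Proof.
move=> hq [D hD]; exists (C * D) => t i.
by rewrite linearZ /= normrM ler_pM.
Qed.

Lemma bounded_seq_sum (I : Type) (s : seq I) (f : I -> nat -> L) :
  (forall i, bounded_seq (f i)) -> bounded_seq (fun t => \sum_(i <- s) f i t).
Proof.
move=> hf; elim: s => [|i s IH].
  by apply: eq_bounded_seq (bounded_seq_cst 0) => t; rewrite big_nil.
by apply: eq_bounded_seq (bounded_seqD (hf i) IH) => t; rewrite big_cons.
Qed.

Lemma bounded_seq_linear (g : L -> L) f : linear g -> bounded_seq f ->
  bounded_seq (fun t => g (f t)).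
Proof.
move=> lg [C hC].
pose G : {linear L -> L} := HB.pack g (GRing.isLinear.Build _ _ _ _ g lg).
have Gf t : \sum_i coord lam i (f t) *: g lam`_i = g (f t).
  rewrite -[g]/(G : L -> L) [f t in RHS](basis_expand vbasis_fullP) linear_sum.
  by apply: eq_bigr => i _; rewrite linearZ.
apply: (eq_bounded_seq Gf); apply: bounded_seq_sum => i.
by apply: (@bounded_seqZ _ C _ _ (bounded_seq_cst _)) => t; apply: hC.
Qed.

Lemma bounded_seqM f g :
  bounded_seq f -> bounded_seq g -> bounded_seq (fun t => f t * g t).
Proof.
move=> [C hC] hg.
have E t : \sum_i coord lam i (f t) *: (lam`_i * g t) = f t * g t.
  rewrite [f t in RHS](basis_expand vbasis_fullP) mulr_suml.
  by apply: eq_bigr => i _; rewrite scalerAl.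
apply: (eq_bounded_seq E); apply: bounded_seq_sum => i.
apply: (@bounded_seqZ _ C) => [t|]; first exact: hC.
apply: bounded_seq_linear hg => q x y.
by rewrite mulrDr scalerAr.
Qed.

Lemma bounded_seq_prod (I : Type) (s : seq I) (f : I -> nat -> L) :
  (forall i, bounded_seq (f i)) -> bounded_seq (fun t => \prod_(i <- s) f i t).
Proof.
move=> hf; elim: s => [|i s IH].
  by apply: eq_bounded_seq (bounded_seq_cst 1) => t; rewrite big_nil.
by apply: eq_bounded_seq (bounded_seqM (hf i) IH) => t; rewrite big_cons.
Qed.

Lemma bounded_seq_det n (M : nat -> 'M[L]_n) :
  (forall i j, bounded_seq (fun t => M t i j)) ->
  bounded_seq (fun t => \det (M t)).
Proof.
move=> hM; apply: bounded_seq_sum => s.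
by apply: bounded_seqM; [exact: bounded_seq_cst | exact: bounded_seq_prod].
Qed.

Lemma bounded_seq_adj n (M : nat -> 'M[L]_n) :
  (forall i j, bounded_seq (fun t => M t i j)) ->
  forall i j, bounded_seq (fun t => \adj (M t) i j).
Proof.
move=> hM i j.
have E t : (-1) ^+ (j + i) * \det (row' j (col' i (M t))) = \adj (M t) i j.
  by rewrite mxE.
apply: (eq_bounded_seq E); apply: bounded_seqM; first exact: bounded_seq_cst.
apply: bounded_seq_det => k l.
by apply: eq_bounded_seq (hM (lift j k) (lift i l)) => t; rewrite !mxE.
Qed.

(* An order of [L], given without a basis: the multiplier ring of the lattice
   spanned by [lam]. *)
Definition mul_integral : {pred L} := fun c => regmx lam c \is a mxOver Num.int.

Lemma mul_integralE c :
  (c \in mul_integral) = (regmx lam c \is a mxOver Num.int).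
Proof. by []. Qed.

Lemma mul_integral_subring : subring_closed mul_integral.
Proof.
split=> [|x y|x y]; rewrite !mul_integralE.
- by rewrite (regmx1 vbasis_fullP) mxOver_scalar ?rpred0 ?rpred1.
- move=> /mxOverP hx /mxOverP hy; apply/mxOverP => i j.
  by rewrite regmxD regmxN mxE [X in _ + X]mxE rpredB ?hx ?hy.
- by move=> hx hy; rewrite (regmxM vbasis_fullP) mxOverM.
Qed.
HB.instance Definition _ :=
  GRing.isSubringClosed.Build L mul_integral mul_integral_subring.

(** The row of the [lam_i] is an eigenvector, with eigenvalue [c], of the transpose of the integer
    matrix of [c]; hence [c] is a root of a monic integer polynomial. *)
Lemma mul_integral_integral c :
  c \in mul_integral -> integralOver (intr : int -> L) c.
Proof.
rewrite mul_integralE => /mxOverP hc.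
have [M EM] : exists M : 'M[int]_d, forall i j, (M j i)%:~R = regmx lam c i j.
  exists (\matrix_(i, j) Num.floor (regmx lam c j i)) => i j.
  by rewrite mxE; apply/eqP; rewrite -intrEfloor.
exists (char_poly M); first exact: char_poly_monic.
rewrite map_char_poly -eigenvalue_root_char; apply/eigenvalueP.
exists (\row_i lam`_i).
  apply/rowP => i; rewrite [LHS]mxE [RHS]mxE [in RHS]mxE (regmxE vbasis_fullP).
  by apply: eq_bigr => j _; rewrite -EM scaler_int mxE [in LHS]mxE mulrzr.
have d0 : (0 < d)%N by rewrite adim_gt0.
apply/negP => /eqP/rowP/(_ (Ordinal d0)); rewrite !mxE => l0.
have := basis_not0 vbasis_fullP (mem_nth 0 (_ : 0 < size lam)%N).
by rewrite size_tuple => /(_ d0); rewrite l0 eqxx.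
Qed.

(** The characteristic polynomial is monic with integral coefficients, and integrality is
    transitive. *)
Lemma integral_eigenvalue n (M : 'M[L]_n) (v : 'rV[L]_n) u :
    M \is a mxOver mul_integral -> v != 0 -> v *m M = u *: v ->
  integralOver (intr : int -> L) u.
Proof.
move=> hM v0 vM; apply: (@integral_root_monic _ _ _ u (char_poly M)).
- exact: char_poly_monic.
- by rewrite -eigenvalue_root_char; apply/eigenvalueP; exists v.
- move=> c /(nthP 0)[i _ <-]; apply: mul_integral_integral.
  exact: (polyOverP (char_poly_polyOver hM)).
Qed.

(** An element is determined by its matrix, and only finitely many integer matrices have entries of
    bounded size. *)
Lemma bounded_integral_pigeonhole (P : nat -> Prop) f :
    bounded_seq f -> (forall t, f t \in mul_integral) -> unbounded P ->
  exists c, unbounded (fun t => P t /\ f t = c).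
Proof.
move=> bf If unbP.
have [C hC] : exists C : nat, forall t i j, `|regmx lam (f t) i j| <= C%:R.
  have /choice[C hC] i : exists C, forall t j, `|regmx lam (f t) i j| <= C.
    have [C hC] := bounded_seqM bf (bounded_seq_cst lam`_i).
    by exists C => t j; rewrite mxE.
  exists (Num.bound (\sum_i `|C i|)) => t i j.
  apply: le_trans (hC i t j) _.
  apply: le_trans (ltW (archi_boundP (sumr_ge0 _ _))) => //.
  rewrite (le_trans (ler_norm _)) // (bigD1 i) //= lerDl.
  by rewrite sumr_ge0.
pose k t i j := Num.floor (regmx lam (f t) i j).
have kE t i j : (k t i j)%:~R = regmx lam (f t) i j.
  by apply/esym/eqP; rewrite eq_sym -intrEfloor; apply: (mxOverP (If t)).
have kC t i j : (`|k t i j| < C.+1)%N.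
  rewrite ltnS -lez_nat abszE -(ler_int rat) intr_norm kE.
  exact: hC.
(* Absolute value and sign together recover each integer entry from finite data. *)
pose code t := [ffun ij : 'I_d * 'I_d =>
  (Ordinal (kC t ij.1 ij.2), k t ij.1 ij.2 < 0)].
have [c hc] := unbounded_pigeonhole code unbP.
have [s _ [_ cs]] := hc 0%N; exists (f s) => N.
have [t Nt [Pt ct]] := hc N; exists t => //; split=> //.
apply: (regmx_inj vbasis_fullP); apply/matrixP => i j; rewrite -!kE.
have /ffunP/(_ (i, j)) := etrans ct (esym cs); rewrite !ffunE => -[/= ek sk].
by rewrite [k t i j]intEsign [k s i j]intEsign ek sk.
Qed.

Lemma clear_mul_denominators (I : finType) (c : I -> L) :
  exists2 N : nat, (0 < N)%N & forall i, N%:R * c i \in mul_integral.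
Proof.
have [N N0 hN] := clear_denominators
  (fun x : I * ('I_d * 'I_d) => regmx lam (c x.1) x.2.1 x.2.2).
exists N => // i; rewrite mul_integralE; apply/mxOverP => a b.
have -> : N%:R * c i = N%:R *: c i by rewrite scaler_nat mulr_natl.
by rewrite regmxZ mxE; apply: (hN (i, (a, b))).
Qed.

End Bounded.

(** * Absolute values and growth of powers *)

Lemma bernoulli_ineq (R : realDomainType) (h : R) n :
  0 <= h -> 1 + h *+ n <= (1 + h) ^+ n.
Proof.
move=> h0; elim: n => [|n IH]; first by rewrite mulr0n addr0 expr0.
rewrite exprS mulrDl mul1r mulrSr addrA lerD // ler_peMr // exprn_ege1 //.
by rewrite lerDl.
Qed.

Lemma unbounded_exp_le1 (R : archiRealFieldType) (y C : R) :
  unbounded (fun t => y ^+ t <= C) -> y <= 1.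
Proof.
move=> unb; rewrite leNgt; apply/negP => y1.
have h0 : 0 < y - 1 by rewrite subr_gt0.
have [t Nt] := unb (Num.bound (`|C| / (y - 1))).
apply/negP; rewrite -ltNge.
have : `|C| / (y - 1) < t%:R.
  by rewrite (lt_le_trans (archi_boundP _)) ?ler_nat // divr_ge0 // ltW.
rewrite ltr_pdivrMr // => lt; apply: (le_lt_trans (ler_norm C)).
apply: (lt_le_trans lt); rewrite mulr_natl.
have := bernoulli_ineq t (ltW h0); rewrite addrCA subrr addr0; apply: le_trans.
by rewrite lerDr.
Qed.

Section AbsoluteValue.
Variables (R : realType) (F : fieldType) (w : F -> R).
Hypothesis wP : absolute_value w.

Lemma abs_ge0 x : 0 <= w x. Proof. by case: wP. Qed.
Lemma abs_eq0 x : w x = 0 <-> x = 0. Proof. by case: wP. Qed.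
Lemma absM x y : w (x * y) = w x * w y. Proof. by case: wP. Qed.
Lemma absD x y : w (x + y) <= w x + w y. Proof. by case: wP. Qed.

Lemma abs_gt0 x : x != 0 -> 0 < w x.
Proof.
move=> x0; rewrite lt_neqAle abs_ge0 andbT eq_sym.
by apply: contraNneq x0 => /abs_eq0 ->.
Qed.

Lemma abs1 : w 1 = 1.
Proof.
apply: (mulfI (lt0r_neq0 (abs_gt0 (oner_neq0 F)))).
by rewrite -absM !mulr1.
Qed.

Lemma absX x n : w (x ^+ n) = w x ^+ n.
Proof. by elim: n => [|n IH]; rewrite ?abs1 // !exprS absM IH. Qed.

Lemma abs_sum (I : Type) (s : seq I) (f : I -> F) :
  w (\sum_(i <- s) f i) <= \sum_(i <- s) w (f i).
Proof.
elim: s => [|i s IH]; first by rewrite !big_nil (abs_eq0 0).2.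
by rewrite !big_cons (le_trans (absD _ _)) // lerD2l.
Qed.

Lemma abs_root_of_unity x n : (0 < n)%N -> x ^+ n = 1 -> w x = 1.
Proof.
move=> n0 xn1; apply/eqP; rewrite -(@pexpr_eq1 _ _ n) ?abs_ge0 //.
by rewrite -absX xn1 abs1.
Qed.

(* The powers of [x] stay in the finitely generated group [Z[x]], so they are
   bounded: no ultrametric inequality is needed. *)
Lemma abs_integral_le1 x :
    (forall m : int, w m%:~R <= 1) -> integralOver (intr : int -> F) x ->
  w x <= 1.
Proof.
move=> wint [p mp px].
apply: (@unbounded_exp_le1 _ _ (\sum_(i < size p) w x ^+ i)) => N.
exists N => //; rewrite -absX.
(* As [p] is monic, division over the integers writes [x ^+ N] as an integer combination of the
   powers of [x] below [size p], a range independent of [N]. *)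
pose r := Pdiv.Ring.rmodp 'X^N p.
have -> : x ^+ N = \sum_(i < size p) (r`_i)%:~R * x ^+ i.
  have := Pdiv.RingMonic.rdivp_eq mp 'X^N.
  move=> /(congr1 (map_poly (intr : int -> F))); rewrite rmorphD rmorphM /=.
  rewrite map_polyXn => /(congr1 (horner^~ x)).
  rewrite hornerXn hornerD hornerM (rootP px) mulr0 add0r => ->.
  rewrite (@horner_coef_wide _ (size p)).
    by apply: eq_bigr => i _; rewrite coef_map.
  rewrite (leq_trans (size_poly _ _)) // ltnW // Pdiv.Ring.ltn_rmodpN0 //.
  exact: monic_neq0.
apply: (le_trans (abs_sum _ _)); apply: ler_sum => i _.
by rewrite absM absX ler_piMl // exprn_ge0 // abs_ge0.
Qed.

End AbsoluteValue.

Lemma padic_abs_int_le1 (R : realType) (p : nat) (m : int) :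
  prime p -> padic_abs R p m%:~R <= 1.
Proof.
move=> pp; rewrite /padic_abs; case: ifP => _ //.
rewrite denq_int logn1 sub0r -exprnN invf_le1 ?exprn_gt0 ?ltr0n ?prime_gt0 //.
by rewrite exprn_ege1 // ler1n prime_gt0.
Qed.

Section Archimedean.
Variables (R : realType) (L : fieldExtType rat) (w : L -> R).
Hypotheses (wP : absolute_value w) (warch : forall q : rat, w q%:A = `|ratr q|).

Lemma arch_bounded f : bounded_seq f -> exists C : R, forall t, w (f t) <= C.
Proof.
move=> [C hC]; exists (\sum_(i < \dim {:L}) ratr C * w (vbasis {:L})`_i) => t.
rewrite [f t](basis_expand (vbasis_fullP L)) (le_trans (abs_sum wP _ _)) //.
apply: ler_sum => i _; rewrite -mulr_algl absM // warch ler_wpM2r ?abs_ge0 //.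
by rewrite -ratr_norm ler_rat.
Qed.

End Archimedean.

(** * An order inside the coefficient ring of the module *)

Section RelativeOrder.
Variables (L : fieldExtType rat) (K : {subfield L}) (e : nat).
Variables (omega : e.-tuple (fieldOver K)).
Hypothesis homega : basis_of (fullv : {vspace fieldOver K}) omega.
Local Notation A := (relmx omega).
Local Notation N := (rel_norm K).
Let NE := rel_normE homega.

(** Entries in [mul_integral] are algebraic integers of [K], so such [x] preserve the module. This
    ring is used in place of the whole coefficient ring because its relative norms lie in
    [mul_integral], where bounded sets are finite. *)
Definition in_order (x : L) := A x \is a mxOver (@mul_integral L).

Lemma tnth_omega_neq0 i : (tnth omega i : L) != 0.
Proof. exact: (basis_not0 homega (mem_tnth i omega)). Qed.

Lemma size_omega_gt0 : (0 < e)%N.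
Proof.
case: (e) omega homega => [|//] om /size_basis => h0.
by have := adim_gt0 {: fieldOver K}%AS; rewrite h0.
Qed.

Lemma relmx_linear_entry i j : linear (fun x => A x i j).
Proof.
move=> q x y; rewrite relmxD -(mulr_algl q x) relmxZ ?rpredZ ?rpred1 //.
by rewrite mxE [in LHS]mxE mulr_algl.
Qed.

Lemma relmx_sum (I : Type) (s : seq I) (f : I -> L) :
  A (\sum_(i <- s) f i) = \sum_(i <- s) A (f i).
Proof.
apply: (big_morph A (relmxD omega)).
by have := relmxZ omega 1 (mem0v K); rewrite mul0r scale0r.
Qed.

Lemma relnormM x y : N (x * y) = N x * N y.
Proof. by rewrite !NE relmxM // det_mulmx. Qed.

Lemma relnorm1 : N 1 = 1.
Proof. by rewrite NE relmx1 // det1. Qed.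

Lemma relnormX x n : N (x ^+ n) = N x ^+ n.
Proof. by elim: n => [|n IH]; rewrite ?relnorm1 // !exprS relnormM IH. Qed.

Lemma relnorm_neq0 x : x != 0 -> N x != 0.
Proof.
move=> x0; apply/eqP => Nx0; have := relnormM x x^-1.
by rewrite mulfV // relnorm1 Nx0 mul0r => /eqP; rewrite oner_eq0.
Qed.

Lemma relnorm_in x : N x \in K.
Proof. exact: subvsP. Qed.

Lemma relnorm_scalar c : c \in K -> N c = c ^+ e.
Proof. by move=> cK; rewrite NE relmx_scalar // det_scalar. Qed.

(** The adjugate is polynomial in the entries of [A x], so the cofactor [N x / x] inherits
    integrality and boundedness from [x]. *)
Lemma relmx_cofactor x : x != 0 -> A (N x / x) = \adj (A x).
Proof.
move=> x0; have AxV : A x^-1 *m A x = 1%:M.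
  by rewrite -relmxM // mulVf // relmx1.
rewrite relmxZ ?relnorm_in // -[RHS]mul1mx -AxV -mulmxA mul_mx_adj -NE.
by rewrite mul_mx_scalar.
Qed.

Lemma in_order1 : in_order 1.
Proof. by rewrite /in_order relmx1 // mxOver_scalar ?rpred0 ?rpred1. Qed.

Lemma in_orderD x y : in_order x -> in_order y -> in_order (x + y).
Proof.
rewrite /in_order => /mxOverP hx /mxOverP hy; apply/mxOverP => i j.
by rewrite relmxD mxE rpredD.
Qed.

Lemma in_orderM x y : in_order x -> in_order y -> in_order (x * y).
Proof.
by move=> hx hy; rewrite /in_order (relmxM homega); apply: mxOverM hx hy.
Qed.

Lemma in_orderZ c x :
  c \in K -> c \in @mul_integral L -> in_order x -> in_order (c * x).
Proof.
by move=> cK cI hx; rewrite /in_order (relmxZ omega x cK); apply: mxOverZ cI hx.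
Qed.

Lemma in_order_int_comb (I : finType) (x : I -> L) (z : I -> int) :
  (forall i, in_order (x i)) -> in_order (\sum_i (z i)%:~R * x i).
Proof.
move=> hx; rewrite /in_order relmx_sum; apply/mxOverP => i j.
rewrite summxE rpred_sum // => k _; rewrite relmxZ ?rpred_int // mxE.
by rewrite rpredM ?rpred_int //; apply: (mxOverP (hx k)).
Qed.

Lemma clear_order_denominators (I : finType) (x : I -> L) :
  exists2 D : nat, (0 < D)%N & forall i, in_order (D%:R * x i).
Proof.
have [D D0 hD] := clear_mul_denominators
  (fun k : I * ('I_e * 'I_e) => A (x k.1) k.2.1 k.2.2).
exists D => // i; apply/mxOverP => a b; rewrite relmxZ ?rpred_nat // mxE.
exact: (hD (i, (a, b))).
Qed.

(** The row of the [omega_i] is an eigenvector of the transpose of [A x] with eigenvalue [x]. *)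
Lemma in_order_integral x : in_order x -> integralOver (intr : int -> L) x.
Proof.
move=> hx.
apply: (@integral_eigenvalue _ _ (A x)^T (\row_i (tnth omega i : L))).
- by apply/mxOverP => i j; rewrite mxE; apply: (mxOverP hx).
- apply/eqP => /rowP/(_ (Ordinal size_omega_gt0)); rewrite !mxE => /eqP.
  by rewrite (negPf (tnth_omega_neq0 _)).
apply/rowP => i; rewrite [LHS]mxE [RHS]mxE [in RHS]mxE relmxE //.
by apply: eq_bigr => j _; rewrite mxE [in LHS]mxE mulrC.
Qed.

Lemma in_order_coef x : in_order x -> coef_ring (full_module omega) x.
Proof.
move=> hx _ [nu hnu ->].
exists (fun j => \sum_i A x i j * nu i).
  move=> j; split.
    by rewrite rpred_sum // => i _; rewrite rpredM ?relmx_in //; case: (hnu i).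
  apply: (big_ind (integralOver (intr : int -> L))).
  - exact: mxpoly.integral0.
  - by move=> ? ?; apply: integral_add.
  move=> i _; apply: integral_mul; last by case: (hnu i).
  by apply: mul_integral_integral; apply: (mxOverP hx).
rewrite mulr_sumr.
under eq_bigr => i _ do rewrite mulrA relmxE // mulr_suml.
rewrite exchange_big /=; apply: eq_bigr => j _; rewrite mulr_sumr.
by apply: eq_bigr => i _; rewrite mulrAC mulrC.
Qed.

Lemma order_unit_relative u : u != 0 -> in_order u -> in_order u^-1 ->
  N u = 1 -> relative_units K (full_module omega) u.
Proof.
move=> u0 hu hV Nu; split; last first.
  have i1 : integers K 1 by split; [exact: rpred1 | exact: integral1].
  rewrite Nu; split; last by exists 1%N.
  by split=> //; rewrite ?oner_neq0 ?invr1.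
split; first exact: in_order_coef.
by split=> //; split; rewrite ?memvf //; apply: in_order_integral.
Qed.

(** With [a - b = n c], the quotient is [1 + (n / N b) * (c * (N b / b))]; the scalar lies in [K]
    and is integral, and the cofactor of [b] lies in the order. *)
Lemma in_order_div a b n :
    b != 0 -> in_order b -> N a = N b ->
    n%:R / N b \in @mul_integral L ->
    (exists2 c, in_order c & a - b = n%:R * c) ->
  in_order (a / b).
Proof.
move=> b0 hb Nab hn [c hc Eab].
have Nb0 := relnorm_neq0 b0.
have -> : a / b = 1 + n%:R / N b * (c * (N b / b)).
  rewrite -[a in LHS](subrK b) Eab mulrDl mulfV // addrC; congr (_ + _).
  by rewrite [c * _]mulrCA [RHS]mulrA divfK // mulrA.
apply: in_orderD in_order1 (in_orderZ _ hn (in_orderM hc _)).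
  by rewrite rpred_div ?rpred_nat // relnorm_in.
by rewrite /in_order (relmx_cofactor b0); apply: adj_mxOver hb.
Qed.

End RelativeOrder.

(** * Rank zero and elements of relative norm 1 *)

Lemma rank0_torsion (F : fieldType) (G : set F) u : has_rank G 0 -> G u ->
  u != 0 -> exists2 n : nat, (0 < n)%N & u ^+ n = 1.
Proof.
move=> [_ hG] Gu u0.
have : ~ mult_independent (fun _ : 'I_1 => u) by move=> /(hG _ _ (fun=> Gu)).
move=> /existsNP[m /not_implyP[um /existsNP[i mi]]].
move: um mi; rewrite big_ord1 (ord1 i); case: (m 0) => [[|n]|n].
- by move=> _ /(_ erefl).
- by move=> un _; exists n.+1.
- by rewrite NegzE -exprnN => /eqP; rewrite invr_eq1 => /eqP un _; exists n.+1.
Qed.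

Section UnitTheorem.
Variables (R : realType) (L : fieldExtType rat) (K : {subfield L}) (e : nat).
Variables (omega : e.-tuple (fieldOver K)).
Hypothesis homega : basis_of (fullv : {vspace fieldOver K}) omega.
Hypothesis hrank : has_rank (relative_units K (full_module omega)) 0.
Variable w : L -> R.
Hypotheses (wP : absolute_value w) (warch : forall q : rat, w q%:A = `|ratr q|).
Local Notation A := (relmx omega).
Local Notation N := (rel_norm K).
Local Notation lam := (vbasis {:L}).
Local Notation d := (\dim {:L}).

(* Multiplication by [phi ^+ t] does not increase the covolume of the lattice
   spanned by [D *: lam]. *)
Lemma short_order_vectors phi (D : nat) : phi != 0 ->
    `|\det (regmx lam phi)| <= 1 -> (0 < D)%N ->
  exists z : nat -> 'I_d -> int,
    (forall t, \sum_i (z t i)%:~R * (D%:R * lam`_i) != 0 :> L) /\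
    bounded_seq (fun t => phi ^+ t * \sum_i (z t i)%:~R * (D%:R * lam`_i)).
Proof.
move=> phi0 dphi D0; have hl := vbasis_fullP L.
have d0 : (0 < d)%N by rewrite adim_gt0.
have detX t : \det (regmx lam (phi ^+ t)) = \det (regmx lam phi) ^+ t.
  elim: t => [|t IH]; rewrite ?regmx1 ?det1 //.
  by rewrite exprS regmxM // det_mulmx IH exprS.
have dphi0 : \det (regmx lam phi) != 0.
  apply/eqP => d00; have := regmx1 hl; rewrite -(mulfV phi0) regmxM //.
  move=> /(congr1 determinant).
  by rewrite det_mulmx d00 mul0r det1 => /esym/eqP; rewrite oner_eq0.
have /choice[z hz] t : exists z : 'rV[int]_d, z != 0 /\
    forall j, `|(map_mx intr z *m regmx lam (phi ^+ t)) 0 j| <= 1.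
  have [|||z z0 hz] := @rat_lattice_box d (regmx lam (phi ^+ t));
    rewrite ?detX //.
  - by rewrite expf_neq0.
  - by rewrite normrX exprn_ile1.
  by exists z.
have E t i : (z t 0 i)%:~R * (D%:R * lam`_i) =
    (D%:R * (z t 0 i)%:~R : rat) *: lam`_i :> L.
  by rewrite -scalerA scaler_nat scaler_int mulr_natl mulrnAr mulrzl.
exists (fun t i => z t 0 i); split=> [t|].
  apply/eqP => s0; have /eqP := (hz t).1; apply; apply/rowP => i; rewrite mxE.
  move: s0; under eq_bigr do rewrite E.
  move=> /(congr1 (coord lam i)); rewrite coord_sum_free ?(basis_free hl) //.
  rewrite linear0 => /eqP; rewrite mulf_eq0 pnatr_eq0 intr_eq0.
  move=> /orP[/eqP D00|/eqP //].
  by rewrite D00 in D0.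
exists D%:R => t j; rewrite mulr_sumr.
have -> : \sum_i phi ^+ t * ((z t 0 i)%:~R * (D%:R * lam`_i)) =
    \sum_j (D%:R * (map_mx intr (z t) *m regmx lam (phi ^+ t)) 0 j) *: lam`_j.
  under eq_bigr do rewrite E -scalerAr regmxE // scaler_sumr.
  rewrite exchange_big /=; apply: eq_bigr => k _.
  rewrite mxE mulr_sumr scaler_suml; apply: eq_bigr => i _.
  by rewrite scalerA [map_mx intr (z t) 0 i]mxE mulrA.
rewrite coord_sum_free ?(basis_free hl) // normrM normr_nat.
by rewrite ler_piMr ?ler0n //; have [_] := hz t.
Qed.

(** Row [i0] of the adjugate expresses [(N x / x) * omega_i0] in the [omega_j]; dividing by
    [omega_i0] leaves bounded coefficients times constants. *)
Lemma bounded_seq_cofactor (x : nat -> L) : (forall t, x t != 0) ->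
  bounded_seq x -> bounded_seq (fun t => N (x t) / x t).
Proof.
move=> x0 bx; pose i0 := Ordinal (size_omega_gt0 homega).
have E t : \sum_j \adj (A (x t)) i0 j *
      ((tnth omega j : L) / (tnth omega i0 : L))
    = N (x t) / x t.
  under eq_bigr do rewrite mulrA.
  rewrite -mulr_suml -(relmx_cofactor homega (x0 t)) -relmxE // mulfK //.
  exact: tnth_omega_neq0.
apply: (eq_bounded_seq E); apply: bounded_seq_sum => j.
apply: bounded_seqM; last exact: bounded_seq_cst.
apply: bounded_seq_adj => k l.
exact: bounded_seq_linear (relmx_linear_entry omega k l) bx.
Qed.

Lemma bounded_seq_norm (x : nat -> L) :
  bounded_seq x -> bounded_seq (fun t => N (x t)).
Proof.
move=> bx; apply: (@eq_bounded_seq _ (fun t => \det (A (x t)))) => [t|].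
  by rewrite (rel_normE homega).
apply: bounded_seq_det => k l.
exact: bounded_seq_linear (relmx_linear_entry omega k l) bx.
Qed.

Lemma norm1_contracting_abs1 phi : N phi = 1 -> phi != 0 ->
  `|\det (regmx lam phi)| <= 1 -> w phi = 1.
Proof.
move=> Nphi phi0 dphi.
(* The multiples [D * lam_i] span a full lattice inside the order. *)
have [D D0 hD] := clear_order_denominators omega (fun i : 'I_d => lam`_i).
have [z [al0 bx]] := short_order_vectors phi0 dphi D0.
pose al t := \sum_i (z t i)%:~R * (D%:R * lam`_i) : L.
pose x t := phi ^+ t * al t.
have x0 t : x t != 0 by rewrite mulf_neq0 ?expf_neq0 ?al0.
have Nx t : N (x t) = N (al t).
  by rewrite (relnormM homega) (relnormX homega) Nphi expr1n mul1r.
have hal t : in_order omega (al t) by apply: in_order_int_comb.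
(* [N (x t) = N (al t)] is both bounded and in the order, so one value [nu] recurs infinitely
   often. *)
have [|nu hnu] := bounded_integral_pigeonhole (bounded_seq_norm bx) _
    (P := fun=> True) (fun M => ex_intro2 _ _ M (leqnn M) I).
  by move=> t; rewrite Nx (rel_normE homega); apply: det_mxOver; apply: hal.
have [s0 _ [_ nu_s0]] := hnu 0%N.
have nu0 : nu != 0 by rewrite -nu_s0; apply: (relnorm_neq0 homega (x0 s0)).
(* The modulus [n] makes [n / nu] integral, as [in_order_div] requires. It is then written [n.+1],
   so that residues live in ['I_n.+1]. *)
have [n n0 hn] := clear_mul_denominators (fun _ : unit => nu^-1).
case: n n0 hn => // n _ hn.
pose code t := [ffun i : 'I_d => inord `|modz (z t i) n.+1%:Z|%N : 'I_n.+1].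
have [c hc] := unbounded_pigeonhole code hnu.
have [s _ [[_ nu_s] cs]] := hc 0%N.
(* Equal norms and equal residues make [al t / al s] and its inverse lie in the order: a relative
   unit, hence a root of unity. *)
have wal t : N (x t) = nu -> code t = c -> w (al t) = w (al s).
  move=> nu_t ct.
  have modE i : (n.+1%:Z %| z t i - z s i)%Z.
    rewrite -eqz_mod_dvd.
    have /ffunP/(_ i) := etrans ct (esym cs); rewrite !ffunE => /(congr1 val).
    have lt k : (`|modz k n.+1%:Z| < n.+1)%N.
      by rewrite -ltz_nat gez0_abs ?modz_ge0 // ltz_pmod.
    rewrite /= !inordK ?lt // => /(congr1 Posz).
    by rewrite !gez0_abs ?modz_ge0 // => ->.
  have diff : exists2 c, in_order omega c & al t - al s = n.+1%:R * c.
    exists (\sum_i (divz (z t i - z s i) n.+1%:Z)%:~R * (D%:R * lam`_i)).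
      exact: in_order_int_comb.
    rewrite mulr_sumr -sumrB; apply: eq_bigr => i _.
    rewrite [RHS]mulrA -mulrBl; congr (_ * _).
    by rewrite -rmorphB -{1}(divzK (modE i)) rmorphM mulrC.
  have Nal : N (al t) = N (al s) by rewrite -!Nx nu_t nu_s.
  have hnus : n.+1%:R / N (al s) \in @mul_integral L.
    by rewrite -Nx nu_s; apply: hn tt.
  have ts0 : al t / al s != 0 by rewrite mulf_neq0 ?invr_neq0 ?al0.
  have ru : relative_units K (full_module omega) (al t / al s).
    apply: (order_unit_relative homega ts0).
    - exact: (in_order_div homega (al0 s) (hal s) Nal hnus diff).
    - rewrite invf_div.
      apply: (in_order_div (n := n.+1) homega (al0 t) (hal t) (esym Nal)).
        by rewrite Nal; exact: hnus.
      have [c' hc' Ec] := diff; exists (- c'); last by rewrite mulrN -Ec opprB.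
      by rewrite -mulN1r; apply: in_orderZ hc'; rewrite rpredN rpred1.
    - have := relnormM homega (al t / al s) (al s); rewrite divfK ?al0 // Nal.
      move=> /esym/eqP; rewrite -subr_eq0 -{2}[N (al s)]mul1r -mulrBl mulf_eq0.
      by rewrite (negPf (relnorm_neq0 homega (al0 s))) orbF subr_eq0 => /eqP.
  have [k k0 uk] := rank0_torsion hrank ru ts0.
  have := abs_root_of_unity wP k0 uk => wu.
  by rewrite -[al t in LHS](divfK (al0 s)) absM // wu mul1r.
have wx t : N (x t) = nu -> code t = c -> w (x t) = w phi ^+ t * w (al s).
  by move=> h1 h2; rewrite absM // absX // wal.
have ws0 : 0 < w (al s) by apply: abs_gt0; rewrite ?al0.
have wphi : 0 < w phi by apply: abs_gt0.
apply/eqP; rewrite eq_le; apply/andP; split.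
  (* Upper bound: [w phi ^+ t * w (al s) = w (x t)] is bounded for infinitely many [t]. *)
  have [C hC] := arch_bounded wP warch bx.
  apply: (@unbounded_exp_le1 _ _ (C / w (al s))) => M.
  have [t Mt [[_ h1] h2]] := hc M; exists t => //.
  by rewrite ler_pdivlMr // -(wx t h1 h2); apply: hC.
(* Lower bound: [nu] is [x t] times a bounded cofactor, so [w (x t)] stays away from 0 and the
   powers of [(w phi)^-1] are bounded. *)
have [C hC] := arch_bounded wP warch (bounded_seq_cofactor x0 bx).
rewrite -[w phi]invrK invf_ge1 ?invr_gt0 //.
apply: (@unbounded_exp_le1 _ _ (C * w (al s) / w nu)) => M.
have [t Mt [[_ h1] h2]] := hc M; exists t => //.
have wnu : 0 < w nu by apply: abs_gt0.
rewrite ler_pdivlMr // exprVn mulrC ler_pdivrMr ?exprn_gt0 //.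
rewrite -mulrA [w (al s) * _]mulrC -(wx t h1 h2).
rewrite -{1}[nu](divfK (x0 t)) absM // -{1}h1.
by apply: (ler_wpM2r (abs_ge0 wP _)); apply: hC.
Qed.

(** The determinants of [theta] and [theta^-1] are inverse, so one of the two is at most 1 in
    size. *)
Lemma norm1_abs1 theta : N theta = 1 -> theta != 0 -> w theta = 1.
Proof.
move=> Nt t0.
have [le1|gt1] := leP `|\det (regmx lam theta)| 1.
  exact: norm1_contracting_abs1.
have hl := vbasis_fullP L.
have := regmxM hl theta theta^-1; rewrite mulfV // regmx1 //.
move=> /(congr1 determinant); rewrite det1 det_mulmx => dV.
have wV : w theta^-1 = 1.
  apply: norm1_contracting_abs1; rewrite ?invr_neq0 //.
    have := relnormM homega theta theta^-1.
    by rewrite mulfV // (relnorm1 homega) Nt mul1r.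
  have := congr1 Num.norm dV; rewrite normr1 normrM => /esym dV1.
  rewrite leNgt; apply/negP => gt2.
  by have := mulr_egt1 gt1 gt2; rewrite dV1 ltxx.
by rewrite -[w theta]mulr1 -wV -absM // mulfV // abs1.
Qed.

(** [mu ^+ e / N mu] has relative norm 1, because an element [c] of [K] has norm [c ^+ e]. *)
Lemma abs_rel_norm mu : mu != 0 -> w (N mu) = w mu ^+ e.
Proof.
move=> mu0; have N0 := relnorm_neq0 homega mu0.
have : w (mu ^+ e / N mu) = 1.
  apply: norm1_abs1; last by rewrite mulf_neq0 ?expf_neq0 ?invr_neq0.
  rewrite (relnormM homega) (relnormX homega).
  have NVK : (N mu)^-1 \in K by rewrite rpredV relnorm_in.
  rewrite (relnorm_scalar homega NVK).
  by rewrite -exprMn mulfV // expr1n.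
by move=> h; rewrite -absX // -[mu ^+ e](divfK N0) absM // h mul1r.
Qed.

End UnitTheorem.

(** * Comparison of the heights place by place *)

Section Heights.
Variables (R : realType) (L : fieldExtType rat).

Lemma ln_plus_abs_le1 (w : L -> R) x :
  absolute_value w -> w x <= 1 -> ln_plus (normalized_abs w x) = 0.
Proof.
move=> wP wx; apply/max_l; rewrite /normalized_abs ln_powR.
by rewrite mulr_ge0_le0 ?divr_ge0 ?ler0n // ln_le0.
Qed.

(** The local degree enters both sides through the same factor, so its value does not matter. *)
Lemma ln_plus_abs_exp (w : L -> R) x y n : absolute_value w ->
  w y = w x ^+ n ->
  ln_plus (normalized_abs w y) = n%:R * ln_plus (normalized_abs w x).
Proof.
move=> wP wyx; rewrite /ln_plus /normalized_abs !ln_powR wyx.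
rewrite maxr_pMr ?ler0n // mulr0 mulrCA; congr (Num.max 0 (_ * _)).
(* The convention that [ln 0] is 0 settles the degenerate case. *)
have [->|x0] := eqVneq (w x) 0.
  by case: n {wyx} => [|n]; rewrite ?expr0 ?ln1 ?mul0r // expr0n /= ln0 ?mulr0.
by rewrite lnXn ?mulr_natl // lt_neqAle eq_sym x0 abs_ge0.
Qed.

End Heights.

Theorem theorem1p2 (R : realType) (L : fieldExtType rat) (K : {subfield L})
    (e : nat) (he : e = \dim_K {:L})
    (omega : e.-tuple (fieldOver K))
    (homega : basis_of (fullv : {vspace fieldOver K}) omega)
    (hM : full_module omega `<=` integers {:L}%AS)
    (hrank : has_rank (relative_units K (full_module omega)) 0)
    (beta mu zeta : L)
    (hbeta : integers K beta) (hbeta0 : beta != 0)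
    (hmu : full_module omega mu) (hmu0 : mu != 0)
    (hzeta : tor_units K zeta)
    (hnorm : rel_norm K mu = zeta * beta) :
  weil_height R mu = (e%:R)^-1 * weil_height R beta.
Proof.
have e0 : (e%:R : R) != 0 by rewrite pnatr_eq0 -lt0n (size_omega_gt0 homega).
have term (w : L -> R) : places w ->
    ln_plus (normalized_abs w beta) = e%:R * ln_plus (normalized_abs w mu).
  move=> [wP [warch|[p pp wp]]].
    apply: ln_plus_abs_exp => //.
    rewrite -(abs_rel_norm homega hrank) // hnorm absM //.
    by have [_ [n n0 /(abs_root_of_unity wP n0) ->]] := hzeta; rewrite mul1r.
  (* At a [p]-adic place integral elements have absolute value at most 1, so both terms vanish. *)
  have wint (m : int) : w m%:~R <= 1.
    by have := wp m%:~R; rewrite scaler_int => ->; apply: padic_abs_int_le1.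
  have w1 x : integralOver (intr : int -> L) x ->
      ln_plus (normalized_abs w x) = 0.
    by move=> ix; apply: ln_plus_abs_le1 => //; apply: abs_integral_le1.
  by rewrite !w1 ?mulr0 //; [case: (hM _ hmu) | case: hbeta].
(* The terms agree at each place, so the two sums are equal without any finiteness argument. *)
rewrite /weil_height mulr_fsumr; apply: eq_fsbigr => w /set_mem/term ->.
by rewrite mulKf.
Qed.
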